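(* Let $k\ge 1$ be an integer, let $0<\lambda<1/3$, and let $$ C_{\lambda, n} = \sqrt[k]{\frac{\lambda^2 n^2}{2 \tau_{\lambda}} 2^{f(\lambda) \tau_{\lambda}}} \quad\text{and}\quad \tau_{\lambda} = \left \lceil \frac{1}{2^{f(\lambda)}-1} \right \rceil. $$ Then, for $n$ large enough, there exists a sequence $\Sigma=(a_1,\dots,a_n)$ of $\left( C_{\lambda, n} \cdot 2^{f(\lambda) n/k}\right)$-bounded elements of $\mathbb{Z}^k$ that is $\mathcal{F}_{\lambda,n}$-sum distinct.
   Context: Logarithms are in base $2$, and $f(\lambda)=H(\lambda,\lambda,1-2\lambda)=-2\lambda\log\lambda-(1-2\lambda)\log(1-2\lambda)$, where $H(p_1,\dots,p_h)=\sum_{i=1}^h -p_i\log p_i$ is the Shannon entropy. $\mathcal{F}_{\lambda,n}$ denotes the family of all subsets of $\{1,\dots,n\}$ of size at most $\lambda n$. A sequence $(a_1,\dots,a_n)$ in $\mathbb{Z}^k$ is $M$-bounded (for a real number $M$) if $a_i\in[0,M]^k$ for all $i$. For $A\subseteq\{1,\dots,n\}$ put $S(A)=\sum_{i\in A}a_i$. The sequence is $\mathcal{F}_{\lambda,n}$-sum distinct if $S(A_1)\neq S(A_2)$ for all distinct $A_1,A_2\in\mathcal{F}_{\lambda,n}$. ''Large enough'' may depend on $\lambda$ and $k$. *)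

(* Defs.v *)
From mathcomp Require Import all_boot all_order all_algebra.
From mathcomp Require Import reals exp.

Set Implicit Arguments.
Unset Strict Implicit.
Unset Printing Implicit Defensive.

Import Order.TTheory GRing.Theory Num.Theory.
Local Open Scope ring_scope.

Definition log2 {R : realType} (x : R) : R := ln x / ln 2.

(* [ln 0 = 0] in the library, so a zero entry contributes 0, as usual. *)
Definition entropy {R : realType} (p : seq R) : R :=
  \sum_(x <- p) - x * log2 x.

Definition fexp {R : realType} (lam : R) : R :=
  entropy [:: lam; lam; 1 - 2 * lam].

Lemma fexpE {R : realType} (lam : R) :
  fexp lam = - 2 * lam * log2 lam - (1 - 2 * lam) * log2 (1 - 2 * lam).
Proof.
by rewrite /fexp /entropy !big_cons big_nil addr0 addrA -mulrDl -opprD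
  mulNr [- (1 - _) * _]mulNr mulNr mulr_natl mulr2n mulNr.
Qed.

Definition tau {R : realType} (lam : R) : int :=
  Num.ceil (1 / (2 `^ fexp lam - 1)).

(* For [k > 0] the exponent [k%:R^-1] expresses the k-th root of a nonnegative
   real. *)
Definition Cbound {R : realType} (k : nat) (lam : R) (n : nat) : R :=
  (lam ^+ 2 * n%:R ^+ 2 / (2 * (tau lam)%:~R)
     * 2 `^ (fexp lam * (tau lam)%:~R)) `^ k%:R^-1.

Definition small_sets {R : realType} (lam : R) (n : nat) : {set {set 'I_n}} :=
  [set A : {set 'I_n} | #|A|%:R <= lam * n%:R].

(* Elements of Z^k are integer row vectors; sequences of length n are indexed
   by ['I_n], i.e. by 0, ..., n-1. *)
Definition bounded_seq {R : realType} (n k : nat) (M : R)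
    (a : 'I_n -> 'rV[int]_k) : Prop :=
  forall (i : 'I_n) (j : 'I_k), 0 <= ((a i 0 j)%:~R : R) <= M.

Definition subset_sum (n k : nat) (a : 'I_n -> 'rV[int]_k)
    (A : {set 'I_n}) : 'rV[int]_k :=
  \sum_(i in A) a i.

Definition sum_distinct (n k : nat) (F : {set {set 'I_n}})
    (a : 'I_n -> 'rV[int]_k) : Prop :=
  forall A1 A2 : {set 'I_n}, A1 \in F -> A2 \in F -> A1 <> A2 ->
    subset_sum a A1 <> subset_sum a A2.

(* Main.v *)
Require Import Defs.
From mathcomp Require Import all_boot all_order all_algebra.
From mathcomp Require Import reals exp.
From mathcomp Require Import sequences ring lra.

(** A sequence [a] fails to be sum distinct when some difference
    [1_A1 - 1_A2] of indicators of small sets is a nonzero ternary vector [e]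
    with [\sum_i e_i a_i = 0]; such an [e] has at most [lam * n] entries [1]
    and at most [lam * n] entries [-1].

    There are at most [2 ^ (n f(lam))] vectors of this kind
    ([card_light_patterns]).  Draw the entries of a ternary vector
    independently, [1] and [-1] with probability [lam] each and [0] with probability
    [1 - 2 lam].  As [lam < 1 - 2 lam], each of the vectors above has
    probability at least [lam ^ (2 lam n) * (1 - 2 lam) ^ ((1 - 2 lam) n)],
    which is [2 ^ (- n f(lam))], and the probabilities add up to at most [1].

    Let the terms of [a] range over the integer points of the cube [[0, M]^k].
    A relation [\sum_i e_i a_i = 0] with [e != 0] determines one term of [a]
    from the others, so a proportion at most [1 / P] of all sequences satisfies
    it, [P] being the number of points of the cube.  By the union bound a good
    sequence exists as soon as [P] exceeds the number of vectors [e]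
    ([exists_avoiding]).

    Finally [P > M ^ k], and with the [M] of the theorem
    [M ^ k = Cbound ^ k * 2 ^ (n f(lam))], where [Cbound ^ k] is a positive
    constant times [n ^ 2], hence at least [1] for large [n]. *)

Set Implicit Arguments.
Unset Strict Implicit.
Unset Printing Implicit Defensive.

Import Order.TTheory GRing.Theory Num.Theory.
Local Open Scope ring_scope.

(** * A union bound for constraints that determine one coordinate *)

(** Freeing the determined coordinate [i] injects pairs (bad sequence, value at
    [i]) into all sequences. *)
Lemma card_determined (I T : finType) (B : {set {ffun I -> T}}) (i : I) :
    (forall a b, a \in B -> b \in B -> (forall j, j != i -> a j = b j) ->
       a i = b i) ->
  (#|B| * #|T| <= #|{ffun I -> T}|)%N.
Proof.
move=> Bdet; rewrite -cardsT -cardsX.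
pose g (p : {ffun I -> T} * T) := [ffun j => if j == i then p.2 else p.1 j].
rewrite -(card_in_imset (f := g)) ?max_card // => -[a s] [b t].
rewrite !inE !andbT /= => aB bB /ffunP gE.
have st : s = t by move: (gE i); rewrite !ffunE eqxx.
have abE j : j != i -> a j = b j.
  by move=> /negPf ji; move: (gE j); rewrite !ffunE ji.
rewrite st; congr pair; apply/ffunP => j.
by have [->|/abE//] := eqVneq j i; apply: Bdet.
Qed.

(** A uniformly random [a] is bad for a given [e] with probability at most
    [1 / #|T|], hence for some [e] with probability at most
    [#|D| / #|T| < 1]. *)
Lemma exists_avoiding (I T E : finType) (D : {set E})
    (bad : E -> {set {ffun I -> T}}) :
    (forall e, e \in D -> exists i, forall a b, a \in bad e -> b \in bad e ->
       (forall j, j != i -> a j = b j) -> a i = b i) ->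
    (#|D| < #|T|)%N ->
  exists a, forall e, e \in D -> a \notin bad e.
Proof.
move=> Ddet DT; set N := #|{ffun I -> T}|.
have N_gt0 : (0 < N)%N by rewrite /N card_ffun expn_gt0 (leq_ltn_trans _ DT).
have small : (#|\bigcup_(e in D) bad e| < N)%N.
  rewrite -(ltn_pmul2r (leq_ltn_trans (leq0n _) DT)).
  apply: (@leq_ltn_trans (#|D| * N)); last by rewrite mulnC ltn_pmul2l.
  apply: (@leq_trans ((\sum_(e in D) #|bad e|) * #|T|)).
    rewrite leq_mul2r; apply/orP; right.
    elim/big_rec2: _ => [|e m B _ le_B]; first by rewrite cards0.
    by rewrite (leq_trans (leq_card_setU _ _)) ?leq_add2l.
  rewrite big_distrl /= -sum_nat_const.
  by apply: leq_sum => e /Ddet[i]; apply: card_determined.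
have [a aP] : exists a, a \notin \bigcup_(e in D) bad e.
  apply/existsP; rewrite -negb_forall; apply: contraL small => /forallP allB.
  by rewrite -leqNgt subset_leq_card //; apply/subsetP => a _; apply: allB.
by exists a => e eD; apply: contra aP => ea; apply/bigcupP; exists e.
Qed.

(** * Differences of indicators as ternary patterns *)

(** [Some true], [Some false] and [None] stand for the coefficients [1], [-1]
    and [0]. *)
Definition act (V : zmodType) (o : option bool) (x : V) : V :=
  if o is Some b then if b then x else - x else 0.

Definition diff_pattern (I : finType) (A B : {set I}) :
    {ffun I -> option bool} :=
  [ffun i => if i \in A :\: B then Some true
             else if i \in B :\: A then Some false else None].

Lemma sum_diff_pattern (I : finType) (V : zmodType) (A B : {set I})
    (a : I -> V) :
  \sum_i act (diff_pattern A B i) (a i) =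
    \sum_(i in A) a i - \sum_(i in B) a i.
Proof.
rewrite [in RHS]big_mkcond [X in _ - X]big_mkcond -sumrB.
apply: eq_bigr => i _; rewrite ffunE !inE.
by case: (i \in A); case: (i \in B); rewrite /= ?subrr ?subr0 ?sub0r.
Qed.

Lemma diff_pattern_neq0 (I : finType) (A B : {set I}) :
  A <> B -> exists i, diff_pattern A B i != None.
Proof.
move=> AB; apply/existsP; apply: contra_notT AB.
rewrite negb_exists => /forallP h; apply/setP => i.
by move: (h i); rewrite negbK ffunE !inE; do 2!case: (i \in _).
Qed.

Lemma card_preim_diff_pattern (I : finType) (A B : {set I}) :
  (#|[set i | diff_pattern A B i == Some true]| <= #|A|)%N /\
  (#|[set i | diff_pattern A B i == Some false]| <= #|B|)%N.
Proof.
by split; apply/subset_leq_card/subsetP => i; rewrite !inE ffunE !inE;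
  do 2!case: (i \in _).
Qed.

Lemma act_inj (V : zmodType) (o : option bool) :
  o != None -> injective (@act V o).
Proof. by case: o => [[]|] // _ x y //= /oppr_inj. Qed.

(** A vanishing signed sum determines any term with nonzero coefficient. *)
Lemma relation_determines (I T : finType) (V : zmodType) (v : T -> V)
    (e : I -> option bool) (i : I) (a b : I -> T) :
    injective v -> e i != None ->
    \sum_j act (e j) (v (a j)) = 0 -> \sum_j act (e j) (v (b j)) = 0 ->
    (forall j, j != i -> a j = b j) ->
  a i = b i.
Proof.
move=> v_inj ei; rewrite (bigD1 i) //= => Sa; rewrite (bigD1 i) //= => Sb ab.
apply/v_inj/(act_inj ei).
apply: (@addIr _ (\sum_(j | j != i) act (e j) (v (a j)))).
rewrite {}Sa -[LHS]Sb; congr (_ + _).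
by apply: eq_bigr => j /ab ->.
Qed.

(** * Counting ternary patterns with few nonzero entries *)

Definition light_patterns {R : realType} (lam : R) (n : nat) :
    {set {ffun 'I_n -> option bool}} :=
  [set e : {ffun 'I_n -> option bool} |
    (#|[set i | e i == Some true]|%:R <= lam * n%:R) &&
    (#|[set i | e i == Some false]|%:R <= lam * n%:R)].

Section Counting.
Variables (R : realType) (lam : R).
Hypotheses (lam_gt0 : 0 < lam) (lam_lt : lam < 1 / 3).

Let step_prob (o : option bool) : R := if o is Some _ then lam else 1 - 2 * lam.

Lemma sum_step_prob (n : nat) :
  \sum_(e : {ffun 'I_n -> option bool}) \prod_i step_prob (e i) = 1.
Proof.
rewrite -(bigA_distr_bigA (fun (_ : 'I_n) o => step_prob o)) /=.
apply: big1 => i _.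
rewrite (bigD1 None) //= (bigD1 (Some true)) //= (bigD1 (Some false)) //=.
by rewrite big_pred0 => [|[[]|]//]; ring.
Qed.

Lemma expR_ln2M (x : R) : 2 `^ x = expR (x * ln 2).
Proof. by rewrite /powR pnatr_eq0. Qed.

Lemma fexp_ln2 :
  fexp lam * ln 2 = - (2 * lam * ln lam + (1 - 2 * lam) * ln (1 - 2 * lam)).
Proof.
have : ln 2 != 0 :> R by rewrite gt_eqF // ln_gt0 // ltr1n.
by rewrite fexpE /log2 => ?; field.
Qed.

Lemma fexp_gt0 : 0 < fexp lam.
Proof.
have ln2 : 0 < ln 2 :> R by rewrite ln_gt0 // ltr1n.
rewrite -(pmulr_lgt0 _ ln2) fexp_ln2 oppr_gt0.
have lnl : ln lam < 0 by apply: ln_lt0; move: lam_gt0 lam_lt; lra.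
have lnm : ln (1 - 2 * lam) < 0 by apply: ln_lt0; move: lam_gt0 lam_lt; lra.
have mid : (1 - 2 * lam) * ln (1 - 2 * lam) < 0.
  by rewrite pmulr_rlt0 //; move: lam_lt; lra.
have low : lam * ln lam < 0 by rewrite pmulr_rlt0.
by rewrite -mulrA; lra.
Qed.

Lemma tau_gt0 : 0 < tau lam.
Proof.
rewrite /tau ceil_gt0 divr_gt0 // subr_gt0 expR_ln2M.
by rewrite expR_gt1 mulr_gt0 ?fexp_gt0 // ln_gt0 // ltr1n.
Qed.

(** The exponent of the probability is linear in the number [s] of nonzero
    entries, with slope [ln lam - ln (1 - 2 lam) <= 0], and equals
    [- n f(lam) ln 2] at the largest value [s = 2 lam n]. *)
Lemma light_pattern_prob (n : nat) (e : {ffun 'I_n -> option bool}) :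
  e \in light_patterns lam n ->
  2 `^ (- (fexp lam * n%:R)) <= \prod_i step_prob (e i).
Proof.
rewrite inE => /andP[le_t le_f].
set t := #|_|%:R in le_t; set f := #|_|%:R in le_f.
have m_gt0 : 0 < 1 - 2 * lam by move: lam_lt; lra.
have le_ln : ln lam <= ln (1 - 2 * lam).
  by rewrite ler_ln ?posrE //; move: lam_lt; lra.
have -> : \prod_i step_prob (e i) =
    expR (n%:R * ln (1 - 2 * lam) + (t + f) * (ln lam - ln (1 - 2 * lam))).
  (* Written as sums over the coordinates, [n], [t] and [f] split the
     exponential into one factor per coordinate. *)
  have -> : n%:R = \sum_(i < n) 1 :> R by rewrite sumr_const card_ord.
  rewrite /t /f -!sum1_card !natr_sum 2![\sum_(i in _) _]big_mkcond -big_split /=.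
  rewrite !mulr_suml -big_split expR_sum; apply: eq_bigr => i _ /=.
  rewrite !inE; case: (e i) => [[]|] /=; rewrite ?eqxx /= -[LHS]lnK ?posrE //;
  by congr expR; ring.
rewrite expR_ln2M ler_expR mulNr mulrAC fexp_ln2.
have : 0 <= (2 * lam * n%:R - (t + f)) * (ln (1 - 2 * lam) - ln lam).
  by rewrite mulr_ge0 ?subr_ge0 //; move: le_t le_f; lra.
lra.
Qed.

(** Each light pattern has probability at least [2 ^ (- n f(lam))], and distinct
    patterns are disjoint events. *)
Lemma card_light_patterns (n : nat) :
  #|light_patterns lam n|%:R <= 2 `^ (fexp lam * n%:R).
Proof.
rewrite -[leRHS]mul1r -ler_pdivrMr ?powR_gt0 // -powRN -[leRHS](sum_step_prob n).
rewrite mulrC -sumr_const mulr_sumr.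
apply: (@le_trans _ _ (\sum_(e in light_patterns lam n)
    \prod_i step_prob (e i))).
  by apply: ler_sum => e; rewrite mulr1; apply: light_pattern_prob.
rewrite [leRHS](bigID (mem (light_patterns lam n))) /= lerDl sumr_ge0 // => e _.
apply: prodr_ge0 => i _; rewrite /step_prob.
by case: (e i) => [_|]; move: lam_gt0 lam_lt; lra.
Qed.

(** [Cbound ^ k] is [K * n ^ 2] with [K > 0] independent of [n], so
    [n >= 1] with [n >= 1 / K] suffices. *)
Lemma Cbound_exp_ge1 (k : nat) : (0 < k)%N ->
  exists n0 : nat, forall n, (n0 <= n)%N -> 1 <= (Cbound k lam n) ^+ k.
Proof.
move=> k_gt0.
set K := lam ^+ 2 / (2 * (tau lam)%:~R) * 2 `^ (fexp lam * (tau lam)%:~R).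
have K_gt0 : 0 < K.
  by rewrite mulr_gt0 ?powR_gt0 // divr_gt0 ?exprn_gt0 // mulr_gt0 ?ltr0z
    ?tau_gt0.
exists (Num.truncn K^-1).+1 => n n0n.
have Kn : K^-1 <= n%:R.
  apply: ltW; apply: (lt_le_trans (truncnS_gt _)).
  by rewrite ler_nat.
have n_ge1 : 1 <= n%:R :> R by rewrite ler1n (leq_ltn_trans _ n0n).
have -> : Cbound k lam n = (K * n%:R ^+ 2) `^ k%:R^-1.
  by rewrite /Cbound /K; congr (_ `^ _); ring.
rewrite -powR_mulrn ?powR_ge0 // -powRrM mulVf ?pnatr_eq0 -?lt0n //.
rewrite powRr1; last by rewrite mulr_ge0 ?exprn_ge0 ?(ltW K_gt0).
have Kn1 : 1 <= K * n%:R by rewrite mulrC -ler_pdivrMr // div1r.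
by rewrite (le_trans Kn1) // ler_pM2l // expr2 ler_peMr.
Qed.

End Counting.

Theorem theorem3p15 (R : realType) (k : nat) (lam : R)
    (hk : (1 <= k)%N) (hlam0 : 0 < lam) (hlam : lam < 1 / 3) :
  exists n0 : nat, forall n : nat, (n0 <= n)%N ->
    exists a : 'I_n -> 'rV[int]_k,
      bounded_seq (Cbound k lam n * 2 `^ (fexp lam * n%:R / k%:R)) a /\
      sum_distinct (small_sets lam n) a.
Proof.
have [n0 n0P] := Cbound_exp_ge1 hlam0 hlam hk.
exists n0 => n /n0P Cge1.
set M := _ * _ `^ _.
have M_ge0 : 0 <= M by rewrite mulr_ge0 ?powR_ge0.
have Mk : M ^+ k = Cbound k lam n ^+ k * 2 `^ (fexp lam * n%:R).
  rewrite exprMn -[in X in _ * X]powR_mulrn ?powR_ge0 // -powRrM divfK //.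
  by rewrite pnatr_eq0 -lt0n.
(* The points of the cube: the bound [truncn M + 1] on the coordinates is what
   makes their number exceed [M ^ k]. *)
pose T := {ffun 'I_k -> 'I_(Num.truncn M).+1}.
pose v (t : T) : 'rV[int]_k := \row_j (t j : nat)%:Z.
have v_inj : injective v.
  move=> s t /rowP st; apply/ffunP => j; apply/val_inj.
  by move: (st j); rewrite !mxE => -[].
pose D := [set e in light_patterns lam n | [exists i, e i != None]].
pose bad (e : {ffun 'I_n -> option bool}) :=
  [set a : {ffun 'I_n -> T} | \sum_i act (e i) (v (a i)) == 0].
have DT : (#|D| < #|T|)%N.
  rewrite card_ffun !card_ord.
  have le_D : (#|D| <= #|light_patterns lam n|)%N.
    by apply/subset_leq_card/subsetP => e; rewrite inE => /andP[].
  apply: (leq_ltn_trans le_D); rewrite -(ltr_nat R) natrX.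
  apply: (le_lt_trans (card_light_patterns hlam0 hlam n)).
  apply: (@le_lt_trans _ _ (M ^+ k)); first by rewrite Mk ler_peMl ?powR_ge0.
  by rewrite ltr_pXn2r ?nnegrE ?truncnS_gt // lt0n.
have [|a aP] := @exists_avoiding _ _ _ D bad _ DT.
  move=> e; rewrite inE => /andP[_ /existsP[i ei]]; exists i => a b.
  rewrite !inE => /eqP Sa /eqP Sb; exact: (relation_determines v_inj ei Sa Sb).
exists (fun i => v (a i)); split.
  move=> i j; rewrite mxE ler0z /= -[X in X <= _]/((a i j : nat)%:R).
  apply: (@le_trans _ _ (Num.truncn M)%:R); last by rewrite truncn_le.
  by rewrite ler_nat -ltnS.
move=> A B; rewrite !inE => hA hB AB SAB.
have [cA cB] := card_preim_diff_pattern A B.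
have /aP : diff_pattern A B \in D.
  rewrite !inE; apply/andP; split; last by apply/existsP/diff_pattern_neq0.
  by apply/andP; split; [apply: le_trans hA|apply: le_trans hB]; rewrite ler_nat.
by rewrite inE sum_diff_pattern -/(subset_sum _ _) -/(subset_sum _ _) SAB
  subrr eqxx.
Qed.
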